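(* Let $Q$ be a polygonal region and let $r>0$ and $0<\delta<\varepsilon$. If $\textsc{ApproxDecideInterior}(Q,r,\varepsilon,\delta)$ returns YES, then $\textsc{Decide}(Q,r,\varepsilon)$ returns YES as well, which means that there exists a polygonal region $P$ such that $\mathrm{offset}(P,r)$ is $\varepsilon$-close to $Q$. In particular, $P:=\widehat{\Pi}$ (as computed by $\textsc{ApproxDecideInterior}(Q,r,\varepsilon,\delta)$) is such a region.
   Context: A polygonal region is a (closed) set whose boundary consists of finitely many line segments with disjoint interiors; the input $Q$ is bounded. $D_s(c)$ is the closed disk of radius $s$ around $c$, $D_s:=D_s(0)$, $X^C:=\mathbb{R}^2\setminus X$, $\oplus$ is Minkowski sum, $\mathrm{offset}(X,s):=X\oplus D_s$, $\mathrm{inset}(X,s):=\mathrm{offset}(X^C,s)^C=\{x\mid D_s(x)\subseteq X\}$. Closed sets are $\varepsilon$-close if their symmetric Hausdorff distance is at most $\varepsilon$. $\textsc{Decide}(Q,r,\varepsilon)$: $Q_\varepsilon:=\mathrm{offset}(Q,\varepsilon)$, $\Pi:=\mathrm{inset}(Q_\varepsilon,r)$, $Q':=\mathrm{offset}(\Pi,r+\varepsilon)$; return YES if $Q\subseteq Q'$, else NO. For $0\le a<b$, $\bar{D}_{a,b}$ denotes a polygon with rational vertices whose boundary lies in the annulus between the circles of radii $a$ and $b$ around the origin, so that $D_a\subseteq\bar{D}_{a,b}\subseteq D_b$. $\textsc{ApproxDecideInterior}(Q,r,\varepsilon,\delta)$: (1) $\widehat{Q_\varepsilon}:=Q\oplus\widehat{D_\varepsilon}$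 with $\widehat{D_\varepsilon}:=\bar{D}_{\varepsilon-\delta,\varepsilon}$; (2) $\widehat{\Pi}:=(\widehat{Q_\varepsilon}^C\oplus\widehat{D_r})^C$ with $\widehat{D_r}:=\bar{D}_{r,r+\delta}$; (3) $\widehat{Q'}:=\widehat{\Pi}\oplus\widehat{D_{r+\varepsilon}}$ with $\widehat{D_{r+\varepsilon}}:=\bar{D}_{r+\varepsilon-\delta,r+\varepsilon}$; (4) return YES if $Q\subseteq\widehat{Q'}$, otherwise UNDECIDED. *)

(* Defs.v *)
From HB Require Import structures.
From mathcomp Require Export all_boot all_order all_algebra.
From mathcomp Require Export all_classical all_reals all_analysis.

Set Implicit Arguments.
Unset Strict Implicit.
Unset Printing Implicit Defensive.

Import Order.TTheory GRing.Theory Num.Theory numFieldNormedType.Exports.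

Local Open Scope classical_set_scope.
Local Open Scope ring_scope.

(* The library norm on [R * R] is the max norm.  It induces the usual topology
   and the usual bounded sets; every metric notion below goes through the
   Euclidean distance [edist2] instead. *)
Notation plane R := (R * R)%type.

Section Defs.
Variable R : realType.
Implicit Types (p q c x y : plane R) (X Y A B Q D : set (plane R)).
Implicit Types (a b r s t eps delta : R).

Definition edist2 x y : R :=
  Num.sqrt ((x.1 - y.1) ^+ 2 + (x.2 - y.2) ^+ 2).

Definition disk c s : set (plane R) := [set x | edist2 c x <= s].

Definition minkowski X Y : set (plane R) := [set x + y | x in X & y in Y].

Definition offset X s := minkowski X (disk 0 s).

Definition inset X s := ~` (offset (~` X) s).

Definition boundary X : set (plane R) := closure X `\` interior X.

Definition path_point p q t : plane R := (1 - t) *: p + t *: q.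

Definition segment p q : set (plane R) :=
  [set path_point p q t | t in [set t | 0 <= t <= 1]].

(* Equals [set p] when p = q. *)
Definition segment_interior p q : set (plane R) :=
  [set path_point p q t | t in [set t | 0 < t < 1]].

(* Degenerate segments (single points) are allowed: isolated points of a region
   are part of its boundary.  No boundedness is imposed. *)
Definition polygonal_region X : Prop :=
  closed X /\
  exists (n : nat) (u v : 'I_n -> plane R),
    trivIset [set: 'I_n] (fun i => segment_interior (u i) (v i)) /\
    boundary X = \bigcup_(i in [set: 'I_n]) segment (u i) (v i).

(* The closed chain v_0, ..., v_(n-1), v_0 does not meet itself: its
   parametrization by half-open edges is injective. *)
Definition simple_chain n (v : 'I_n -> plane R) : Prop :=
  forall (i j : 'I_n) (s t : R), 0 <= s < 1 -> 0 <= t < 1 ->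
    path_point (v i) (v (ordS i)) s = path_point (v j) (v (ordS j)) t ->
    i = j /\ s = t.

(* D is the closed region enclosed by the simple chain v.  Regular closedness
   ([closure (interior D) = D]) excludes the chain itself. *)
Definition polygon_of n (v : 'I_n -> plane R) D : Prop :=
  [/\ (2 < n)%N, simple_chain v, bounded_set D, closure (interior D) = D &
      boundary D = \bigcup_(i in [set: 'I_n]) segment (v i) (v (ordS i))].

Definition rational_polygon D : Prop :=
  exists (n : nat) (v : 'I_n -> plane R),
    (forall i, rational (v i).1 /\ rational (v i).2) /\ polygon_of v D.

(* The admissible values of the approximate disk with radii a < b. *)
Definition approx_disk a b D : Prop :=
  [/\ rational_polygon D,
      boundary D `<=` [set x | a <= edist2 0 x <= b],
      disk 0 a `<=` D & D `<=` disk 0 b].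

Definition dist_to_set x B : \bar R := ereal_inf [set (edist2 x y)%:E | y in B].

(* Extended-real valued: +oo if exactly one of the sets is empty, and -oo
   (the empty supremum) if both are. *)
Definition hausdorff_dist A B : \bar R :=
  maxe (ereal_sup [set dist_to_set x B | x in A])
       (ereal_sup [set dist_to_set y A | y in B]).

Definition eps_close eps A B : Prop :=
  [/\ closed A, closed B & (hausdorff_dist A B <= eps%:E)%E].

Inductive answer := YES | NO | UNDECIDED.

Definition Decide Q r eps : answer :=
  let Qeps := offset Q eps in
  let Pi := inset Qeps r in
  let Q' := offset Pi (r + eps) in
  if `[< Q `<=` Q' >] then YES else NO.

(* [Dbar a b] is the approximate disk chosen for the radii a < b. *)
Definition hatPi (Dbar : R -> R -> set (plane R)) Q r eps delta :
    set (plane R) :=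
  let hatQeps := minkowski Q (Dbar (eps - delta) eps) in
  ~` (minkowski (~` hatQeps) (Dbar r (r + delta))).

Definition ApproxDecideInterior (Dbar : R -> R -> set (plane R))
    Q r eps delta : answer :=
  let hatQ' := minkowski (hatPi Dbar Q r eps delta)
                 (Dbar (r + eps - delta) (r + eps)) in
  if `[< Q `<=` hatQ' >] then YES else UNDECIDED.

End Defs.

(* Main.v *)
(* The two closeness estimates are chains of inclusions between Minkowski sums.
   The point is that [hatPi] is again a polygonal region.

   Call a set semilinear if membership depends only on the signs of finitely
   many affine functionals.  A closed set bounded by finitely many segments is
   semilinear: the functionals describing these segments cut the plane into
   convex sign cells, and a cell that misses the boundary lies on one side of it
   by connectedness.  Semilinear sets are stable under complement, intersection
   and projection, hence under Minkowski sum.  Conversely, the boundary of a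
   closed bounded semilinear set is a union of cells of the same arrangement,
   each contained in a line; a bounded cell contained in a line is a point or an
   open segment, and distinct cells are disjoint. *)

Require Import Defs.
From mathcomp Require Import ring lra.
Import Order.TTheory GRing.Theory Num.Theory numFieldNormedType.Exports.
Local Open Scope classical_set_scope.
Local Open Scope ring_scope.

Set Implicit Arguments.
Unset Strict Implicit.

(** * Semilinear sets and their Boolean operations *)

Definition affine (R : realType) (V W : lmodType R) (f : V -> W) :=
  forall (t : R) p q,
    f ((1 - t) *: p + t *: q) = (1 - t) *: f p + t *: f q.

(** Equivalently, [X] is a union of sign cells of [l]. Working with cells instead of formulas makes
    Boolean operations immediate. *)
Definition saturated (T I : Type) (R : realType) (l : I -> T -> R) (X : set T) :=
  forall x y, (forall i, Num.sg (l i x) = Num.sg (l i y)) -> X x -> X y.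

Definition semilinear (R : realType) (V : lmodType R) (X : set V) :=
  exists (I : finType) (l : I -> V -> R),
    (forall i, affine (l i : V -> R^o)) /\ saturated l X.

Lemma saturatedC (T I : Type) (R : realType) (l : I -> T -> R) (X : set T) :
  saturated l X -> saturated l (~` X).
Proof. by move=> lX x y lxy nXx Xy; apply/nXx/(lX y) => // i; rewrite lxy. Qed.

Lemma saturatedD (T I : Type) (R : realType) (l : I -> T -> R) (X Y : set T) :
  saturated l X -> saturated l Y -> saturated l (X `\` Y).
Proof.
move=> lX lY x y lxy [Xx nYx]; split; first exact: lX lxy Xx.
exact: saturatedC lY _ _ lxy nYx.
Qed.

Lemma semilinearC (R : realType) (V : lmodType R) (X : set V) :
  semilinear X -> semilinear (~` X).
Proof. by move=> [I [l [al lX]]]; exists I, l; split=> //; exact: saturatedC. Qed.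

Lemma semilinearI (R : realType) (V : lmodType R) (X Y : set V) :
  semilinear X -> semilinear Y -> semilinear (X `&` Y).
Proof.
move=> [I [l [al lX]]] [J [m [am mY]]].
exists (I + J)%type, (fun k => match k with inl i => l i | inr j => m j end).
split=> [[]//|x y lxy [Xx Yx]]; split.
- by apply: lX Xx => i; have := lxy (inl i).
- by apply: mY Yx => j; have := lxy (inr j).
Qed.

Lemma semilinear_preimage (R : realType) (V W : lmodType R) (f : V -> W)
    (X : set W) :
  affine f -> semilinear X -> semilinear (f @^-1` X).
Proof.
move=> af [I [l [al lX]]]; exists I, (fun i => l i \o f); split.
  by move=> i t p q; rewrite /= af al.
by move=> x y lxy; apply: lX.
Qed.

(** * Elimination of coordinates and Minkowski sums *)

(** A cut [t] equal to some [u i] goes to [v i]; any other cut goes to the middle of the gap between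
    the values of [v] that must lie below it and those that must lie above it. *)
Lemma same_order_cut (R : realType) (I : finType) (u v : I -> R) (t : R) :
  (forall i j, Num.sg (u i - u j) = Num.sg (v i - v j)) ->
  exists t', forall i, Num.sg (t - u i) = Num.sg (t' - v i).
Proof.
move=> uv; have [/existsP[i /eqP <-]|/existsPn ut] := boolP [exists i, u i == t].
  by exists (v i) => j; exact: uv.
(* The bounds [- M] and [M] are the defaults when one side of the cut is empty. *)
have [M M0 vM] : exists2 M, 0 < M & forall i, - M < v i < M.
  have v0 (P : pred I) : 0 <= \sum_(j | P j) `|v j| by apply: sumr_ge0.
  exists (1 + \sum_i `|v i|) => [|i]; first by rewrite ltr_pwDl.
  by rewrite -ltr_norml (bigD1 i)//=; have := v0 (predC1 i); rewrite /=; lra.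
pose a := \big[Num.max/- M]_(i | u i < t) v i.
pose b := \big[Num.min/M]_(i | t < u i) v i.
have ab : a < b.
  apply/bigmax_ltP; split.
    by apply/bigmin_gtP; split=> [|i _]; [lra | case/andP: (vM i)].
  move=> i ui; apply/bigmin_gtP; split=> [|j uj]; first by case/andP: (vM i).
  by rewrite -subr_lt0 -sgr_lt0 -uv sgr_lt0; lra.
exists ((a + b) / 2) => i; have [ti|ti|/eqP] := ltgtP t (u i).
- have bv : b <= v i by apply: bigmin_le_cond.
  by rewrite !ltr0_sg//; lra.
- have va : v i <= a by apply: le_bigmax_cond.
  by rewrite !gtr0_sg//; lra.
- by rewrite eq_sym (negbTE (ut i)).
Qed.

(** The point [(v, t)] is the midpoint of [(2 *: v, 0)] and [(0, 2 * t)], and [(v, 0)] that of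
    [(2 *: v, 0)] and the origin; comparing the two leaves only values on the last axis. *)
Lemma affine_last (R : realType) (V : lmodType R) (f : V * R^o -> R^o) v t :
  affine f -> f (v, t) = f (v, 0) + t * (f (0, 1) - f (0, 0)).
Proof.
move=> af; have half2 : (1 - 2^-1 : R) * 2 = 1 by lra.
have E1 : f (v, t) = (1 - 2^-1) * f (2 *: v, 0) + 2^-1 * f (0, 2 * t).
  rewrite -af; congr (f (_, _)) => /=.
    by rewrite scaler0 addr0 scalerA half2 scale1r.
  by rewrite scaler0 add0r /GRing.scale /=; field.
have E2 : f (v, 0) = (1 - 2^-1) * f (2 *: v, 0) + 2^-1 * f (0, 0).
  rewrite -af; congr (f (_, _)) => /=.
    by rewrite scaler0 addr0 scalerA half2 scale1r.
  by rewrite !scaler0 addr0.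
have E3 : f (0, 2 * t) = (1 - 2 * t) * f (0, 0) + (2 * t) * f (0, 1).
  rewrite -af; congr (f (_, _)) => /=; first by rewrite !scaler0 addr0.
  by rewrite scaler0 add0r /GRing.scale /=; ring.
by rewrite E1 E2 E3; field.
Qed.

(* Fourier-Motzkin elimination: on the fibre over [v], the sign of [l i] is
   governed by the position of the last coordinate relative to the root
   [rho i v] (junk value [0] if [l i] does not depend on that coordinate). *)
Lemma semilinear_project (R : realType) (V : lmodType R) (X : set (V * R^o)) :
  semilinear X -> semilinear [set v | exists t, X (v, t)].
Proof.
move=> [I [l [al lX]]].
pose a i := l i (0, 1) - l i (0, 0).
pose rho i v := - (l i (v, 0) / a i).
have arho i : affine (rho i : V -> R^o).
  move=> t p q; rewrite /rho.
  have -> : l i ((1 - t) *: p + t *: q, 0) =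
      (1 - t) * l i (p, 0) + t * l i (q, 0).
    by rewrite -al; congr (l i (_, _)) => /=; rewrite !scaler0 addr0.
  by rewrite /GRing.scale /=; ring.
have lE i v t : l i (v, t) = if a i == 0 then l i (v, 0) else a i * (t - rho i v).
  rewrite (affine_last _ _ (al i)) -/(a i); case: eqVneq => [->|ai].
    by rewrite mulr0 addr0.
  by rewrite /rho; field.
(* The values at height 0 settle the functionals independent of the last coordinate; the differences
   record the order of the roots, as [same_order_cut] requires. *)
exists (I + I * I)%type, (fun k v => match k with
  | inl i => l i (v, 0) | inr (i, j) => rho i v - rho j v end); split.
  case=> [i|[i j]] t p q.
    by rewrite -al; congr (l i (_, _)) => /=; rewrite !scaler0 addr0.
  by rewrite !arho /GRing.scale /=; ring.
move=> v w vw [t Xvt].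
have [t' tt'] := @same_order_cut _ _ (rho^~ v) (rho^~ w) t
  (fun i j => vw (inr (i, j))).
exists t'; apply: lX Xvt => i; rewrite (lE i v t) (lE i w t').
by case: ifP => _; [exact: vw (inl i) | rewrite !sgrM tt'].
Qed.

(** The sum is the projection to [x] of the pairs [(x, y)] with [x - y] in [X] and [y] in [Y]. The
    two coordinates of [y] come last, so that they can be eliminated one at a time. *)
Lemma semilinear_minkowski (R : realType) (X Y : set (plane R)) :
  semilinear X -> semilinear Y -> semilinear (minkowski X Y).
Proof.
move=> sX sY.
pose S : set ((plane R * R^o) * R^o) :=
  [set z | X (z.1.1 - (z.1.2, z.2))] `&` [set z | Y (z.1.2, z.2)].
have sS : semilinear S.
  apply: semilinearI.
    apply: (@semilinear_preimage _ _ _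
      (fun z : (plane R * R^o) * R^o => z.1.1 - (z.1.2, z.2))) sX => t p q.
    by congr (_, _); rewrite /GRing.scale /=; ring.
  exact: (@semilinear_preimage _ _ _
      (fun z : (plane R * R^o) * R^o => (z.1.2, z.2))) sY.
suff -> : minkowski X Y = [set x | exists s, exists t, S ((x, s), t)].
  exact: (semilinear_project (semilinear_project sS)).
apply/seteqP; split=> [_ [x Xx [[s t] Yy] <-]|x [s [t [Xx Yy]]]].
  by exists s, t; split=> //=; rewrite addrK.
by exists (x - (s, t)) => //; exists (s, t) => //; rewrite subrK.
Qed.

(** * Plane regions bounded by segments are semilinear *)

Lemma affine_planeE (R : realType) (f : plane R -> R^o) x :
  affine f ->
  f x = f 0 + x.1 * (f (1, 0) - f 0) + x.2 * (f (0, 1) - f 0).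
Proof.
case: x => x1 x2 af /=.
rewrite (affine_last _ _ (af : affine (f : R^o * R^o -> R^o))).
congr (_ + _); rewrite [LHS](_ : _ = f ((1 - x1) *: (0, 0) + x1 *: (1, 0))).
  by rewrite af /GRing.scale /=; ring.
by congr (f (_, _)); rewrite /= /GRing.scale /=; ring.
Qed.

Lemma affine_continuous (R : realType) (f : plane R -> R^o) :
  affine f -> continuous f.
Proof.
move=> af; rewrite (_ : f = fun x => f 0 + x.1 * (f (1, 0) - f 0) +
  x.2 * (f (0, 1) - f 0)); last by apply/funext => x; exact: affine_planeE.
move=> x; apply: cvgD; first apply: cvgD; first exact: cvg_cst.
  by apply: cvgMl; exact: cvg_fst.
by apply: cvgMl; exact: cvg_snd.
Qed.

(** This is what makes sign cells convex. *)
Lemma sgr_conv (R : realType) (a b t : R) : 0 <= t <= 1 ->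
  Num.sg a = Num.sg b -> Num.sg ((1 - t) * a + t * b) = Num.sg a.
Proof.
move=> t01; have [a0|a0|->] := ltgtP a 0.
- rewrite (ltr0_sg a0) => /esym/eqP; rewrite sgr_cp0 => b0.
  by apply: ltr0_sg; nra.
- rewrite (gtr0_sg a0) => /esym/eqP; rewrite sgr_cp0 => b0.
  by apply: gtr0_sg; nra.
- by rewrite sgr0 => /esym/eqP; rewrite sgr_cp0 => /eqP ->; rewrite !mulr0 addr0 sgr0.
Qed.

(** The product equals [- t (1 - t) (b - a)^2], which treats both orders of [a] and [b] at once. *)
Lemma betweenP (R : realType) (a b x : R) :
  (exists2 t, 0 <= t <= 1 & (1 - t) * a + t * b = x) <->
  (x - a) * (x - b) <= 0.
Proof.
split=> [[t t01 <-]|xab].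
  rewrite (_ : _ * _ = - (t * (1 - t) * (b - a) ^+ 2)); last by ring.
  by rewrite oppr_le0 mulr_ge0 ?sqr_ge0//; nra.
have [ab|ab] := eqVneq a b.
  exists 0; first by rewrite lexx ler01.
  rewrite subr0 mul0r addr0 mul1r; apply/esym/eqP; rewrite -subr_eq0.
  by rewrite -sqrf_eq0 expr2 eq_le {2}ab xab -expr2 sqr_ge0.
have b0 : b - a != 0 by rewrite subr_eq0 eq_sym.
pose t := (x - a) / (b - a).
have E : x = (1 - t) * a + t * b by rewrite /t; field.
exists t => //.
have : t * (1 - t) * (b - a) ^+ 2 >= 0 by move: xab; rewrite {}E; lra.
by rewrite pmulr_lge0 ?exprn_even_gt0//; nra.
Qed.

(** Turns a segment, possibly degenerate, into conditions on the signs of five affine functionals: a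
    cross product for collinearity and four coordinate differences. *)
Lemma segmentE (R : realType) (u v x : plane R) :
  segment u v x <->
  [/\ (v.1 - u.1) * (x.2 - u.2) - (v.2 - u.2) * (x.1 - u.1) = 0,
      (x.1 - u.1) * (x.1 - v.1) <= 0 & (x.2 - u.2) * (x.2 - v.2) <= 0].
Proof.
case: u v x => [u1 u2] [v1 v2] [x1 x2] /=; split.
  move=> [t /= t01 [E1 E2]]; rewrite /GRing.scale /= in E1 E2.
  split; [by rewrite -E1 -E2; ring|apply/betweenP; exists t => //..].
move=> [cr /betweenP[t t01 E1] /betweenP[s s01 E2]].
(* On a vertical line only the second coordinate determines the parameter; otherwise the first one
   does, and collinearity carries it over to the second. *)
have [uv1|uv1] := eqVneq u1 v1.
  exists s => //; congr (_, _); rewrite // /= /GRing.scale /= -E1 -uv1; ring.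
exists t => //; congr (_, _); rewrite // /= /GRing.scale /=.
have d0 : v1 - u1 != 0 by rewrite subr_eq0 eq_sym.
apply: (mulfI d0); apply/eqP; rewrite -subr_eq0; apply/eqP.
by move: cr; rewrite -E1; lra.
Qed.

Lemma path_continuous (R : realType) (p q : plane R) :
  continuous (path_point p q).
Proof.
move=> t; apply: cvgD; apply: cvgZl.
  by apply: cvgB; [exact: cvg_cst|exact: cvg_id].
exact: cvg_id.
Qed.

Lemma plane_segment_connected (R : realType) (p q : plane R) : connected (segment p q).
Proof.
rewrite /segment -set_itvcc; apply: connected_continuous_connected.
  exact: segment_connected.
by apply: continuous_subspaceT; exact: path_continuous.
Qed.

(** The trace of [X] on [A] is closed in [A], and also open in [A] since it equals the trace of the
    interior. *)
Lemma connected_avoids_boundary (R : realType) (X A : set (plane R)) :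
  closed X -> connected A -> A `&` boundary X = set0 ->
  A `&` X !=set0 -> A `<=` X.
Proof.
move=> cX cA AX0 AX; suff <- : A `&` X = A by move=> x [].
apply: cA => //; last by exists X.
exists X°; first exact: open_interior.
apply/seteqP; split=> x [Ax]; last by move=> /interior_subset.
move=> Xx; split=> //; apply: contrapT => nXx.
suff : (A `&` boundary X) x by rewrite AX0.
by split=> //; split=> //; exact: subset_closure.
Qed.

Lemma semilinear_of_boundary (R : realType) (X : set (plane R)) n
    (u v : 'I_n -> plane R) :
  closed X -> boundary X = \bigcup_(i in [set: 'I_n]) segment (u i) (v i) ->
  semilinear X.
Proof.
move=> cX bX.
pose l (k : 'I_n * 'I_5) (x : plane R) := let u := u k.1 in let v := v k.1 in
  match val k.2 with
  | 0%N => (v.1 - u.1) * (x.2 - u.2) - (v.2 - u.2) * (x.1 - u.1)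
  | 1%N => x.1 - u.1 | 2%N => x.1 - v.1 | 3%N => x.2 - u.2 | _ => x.2 - v.2
  end.
have al k : affine (l k : plane R -> R^o).
  move=> t p q; rewrite /l; case: k => i [[|[|[|[|j]]]] jn] /=;
  rewrite /= /GRing.scale /=; ring.
have lB : saturated l (boundary X).
  move=> x y lxy; rewrite bX => -[i _ /segmentE[h0 h1 h2]]; exists i => //.
  have e0 := lxy (i, @Ordinal 5 0 isT); have e1 := lxy (i, @Ordinal 5 1 isT).
  have e2 := lxy (i, @Ordinal 5 2 isT); have e3 := lxy (i, @Ordinal 5 3 isT).
  have e4 := lxy (i, @Ordinal 5 4 isT); rewrite /l /= in e0 e1 e2 e3 e4.
  apply/segmentE; split.
  - by apply/eqP; rewrite -sgr_eq0 -e0 h0 sgr0.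
  - by rewrite -sgr_le0 sgrM -e1 -e2 -sgrM sgr_le0.
  - by rewrite -sgr_le0 sgrM -e3 -e4 -sgrM sgr_le0.
exists ('I_n * 'I_5)%type, l; split => // x y lxy Xx.
(* If [x] is off the boundary, the segment from [x] to [y] stays in their common convex cell and
   hence misses the boundary too. *)
have [Bx|nBx] := pselect (boundary X x).
  by have [] := lB _ _ lxy Bx; rewrite -((closure_id X).1 cX).
have xS : segment x y x by exists 0; rewrite /= ?lexx ?ler01// /path_point
  subr0 scale1r scale0r addr0.
have yS : segment x y y by exists 1; rewrite /= ?lexx ?ler01// /path_point
  subrr scale1r scale0r add0r.
apply: (@connected_avoids_boundary _ X (segment x y)) yS => //; last by exists x.
  exact: plane_segment_connected.
rewrite -subset0 => _ [[t t01 <-] Bt]; apply: nBx.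
apply: lB Bt => k; rewrite /path_point al; apply: sgr_conv => //.
Qed.

(** * Closures and boundaries of unions of cells *)

Lemma affine_shift (R : realType) (f : plane R -> R^o) p q y (t : R) :
  affine f -> f (q + t *: (y - p)) = f q + t * (f y - f p).
Proof.
move=> af; rewrite (affine_planeE (q + _) af) (affine_planeE q af).
rewrite (affine_planeE y af) (affine_planeE p af) /= /GRing.scale /=; ring.
Qed.

Lemma near_same_signs (R : realType) (T : topologicalType) (I : finType)
    (f : I -> T -> R) p :
  (forall i, {for p, continuous (f i)}) ->
  \forall y \near p, forall i, f i p != 0 -> Num.sg (f i y) = Num.sg (f i p).
Proof.
move=> cf; apply: (@filter_forall _ I (fun i y => f i p != 0 ->
  Num.sg (f i y) = Num.sg (f i p)) (nbhs p)) => i.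
have [p0|p0|->] := ltgtP (f i p) 0; last exact: nearW.
  apply: filterS (@cvgr_lt _ _ _ _ _ _ (cf i) _ p0) => y y0 _; by rewrite !ltr0_sg.
apply: filterS (@cvgr_gt _ _ _ _ _ _ (cf i) _ p0) => y y0 _; by rewrite !gtr0_sg.
Qed.

(* A point [y] of [X] close enough to [p] keeps the nonzero signs of [p]; then
   so does [q + t (y - p)] for small [t > 0], while the functionals vanishing
   at [q] acquire the signs they have at [y]. *)
Lemma saturated_closure (R : realType) (I : finType) (l : I -> plane R -> R)
    (X : set (plane R)) :
  (forall i, affine (l i : plane R -> R^o)) -> saturated l X ->
  saturated l (closure X).
Proof.
move=> al lX p q lpq Xp B Bq.
have cl i : continuous (l i) by apply: affine_continuous.
have near_p := near_same_signs (fun i => cl i p).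
have [y [Xy ly]] := Xp _ near_p.
pose g (t : R) : plane R := q + t *: (y - p).
have cg : {for 0, continuous g}.
  apply: cvgD; first exact: cvg_cst.
  by apply: cvgZl; exact: cvg_id.
have g0 : g 0 = q by rewrite /g scale0r addr0.
have lg i t : l i (g t) = l i q + t * (l i y - l i p).
  exact: affine_shift.
have near_g := @near_same_signs _ _ _ (fun i t => l i (g t)) 0
  (fun i => continuous_comp cg (cl i (g 0))).
have [t [t0 Bt gt]] : exists t, [/\ 0 < t, B (g t) &
    forall i, l i (g 0) != 0 -> Num.sg (l i (g t)) = Num.sg (l i (g 0))].
  have near_B : \forall t \near (0 : R), B (g t) by apply: cg; rewrite g0.
  near (0 : R)^'+ => t; exists t; split; near: t.
  - exact: nbhs_right_gt.
  - exact: (cvg_within _ near_B).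
  - exact: (cvg_within _ near_g).
rewrite g0 in gt.
exists (g t); split=> //; apply: lX Xy => i.
have [q0|q0] := eqVneq (l i q) 0.
  have p0 : l i p = 0 by apply/eqP; rewrite -sgr_eq0 lpq q0 sgr0.
  by rewrite lg q0 p0 add0r subr0 sgrM (gtr0_sg t0) mul1r.
by rewrite gt// ly ?lpq// -sgr_eq0 lpq sgr_eq0.
Unshelve. all: by end_near. Qed.

Lemma saturated_boundary (R : realType) (I : finType) (l : I -> plane R -> R)
    (X : set (plane R)) :
  (forall i, affine (l i : plane R -> R^o)) -> saturated l X ->
  saturated l (boundary X).
Proof.
move=> al lX; apply: saturatedD; first exact: saturated_closure.
rewrite -[interior X]setCK -closure_setC.
apply: saturatedC; apply: saturated_closure => //; exact: saturatedC.
Qed.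

(** Otherwise the functionals vanishing at [p] vanish everywhere, and a whole neighbourhood of [p]
    lies in the cell of [p]. As it meets [X], it is contained in [X], and [p] is interior. *)
Lemma boundary_zero (R : realType) (I : finType) (l : I -> plane R -> R)
    (X : set (plane R)) p :
  (forall i, affine (l i : plane R -> R^o)) -> saturated l X -> boundary X p ->
  exists i, l i p = 0 /\ exists x, l i x != 0.
Proof.
move=> al lX [Xp nXp]; apply: contrapT => nE.
have near_p : \forall y \near p, forall i, Num.sg (l i y) = Num.sg (l i p).
  have := @near_same_signs _ _ _ l p (fun i => affine_continuous (al i) (x := p)).
  apply: filterS => y ly i; have [p0|/ly //] := eqVneq (l i p) 0.
  rewrite p0; have [->//|y0] := eqVneq (l i y) 0.
  by exfalso; apply: nE; exists i; split=> //; exists y.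
have [x [Xx lx]] := Xp _ near_p.
apply: nXp; apply: filterS near_p => y ly.
by apply: lX Xx => i; rewrite lx ly.
Qed.

(** * From bounded cells to polygonal regions *)

Lemma bounded_cell (R : realType) (I : finType) (l : I -> plane R -> R) p i0 :
  (forall i, affine (l i : plane R -> R^o)) ->
  l i0 p = 0 -> (exists x, l i0 x != 0) ->
  bounded_set [set y | forall i, Num.sg (l i y) = Num.sg (l i p)] ->
  exists u v, segment_interior u v =
    [set y | forall i, Num.sg (l i y) = Num.sg (l i p)].
Proof.
move=> al lp [x lx]; set C := (X in bounded_set X) => bC.
pose a := l i0 (1, 0) - l i0 0; pose b := l i0 (0, 1) - l i0 0.
have n0 : 0 < a ^+ 2 + b ^+ 2.
  rewrite lt_neqAle addr_ge0 ?sqr_ge0// andbT eq_sym paddr_eq0 ?sqr_ge0//.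
  rewrite !sqrf_eq0; apply/negP => /andP[/eqP a0 /eqP b0].
  move: lp lx; rewrite (affine_planeE p (al i0)) (affine_planeE x (al i0)).
  rewrite -/a -/b a0 b0 !mulr0 !addr0.
  by move=> ->; rewrite eqxx.
(* The gradient [(a, b)] of [l i0] is nonzero, and [d], orthogonal to it, spans the line containing
   the cell. *)
pose d : plane R := (- b, a).
pose m i := l i (p + d) - l i p.
have lpd i t : l i (p + t *: d) = l i p + t * m i.
  by rewrite -{1}(addKr p d) [- p + _]addrC (affine_shift _ _ _ _ (al i)).
have Cline y : C y -> exists t, y = p + t *: d.
  move=> /(_ i0); rewrite lp sgr0 => /eqP; rewrite sgr_cp0 => /eqP ly.
  (* The coefficient of the orthogonal projection of [y - p] onto [d]. *)
  exists ((a * (y.2 - p.2) - b * (y.1 - p.1)) / (a ^+ 2 + b ^+ 2)).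
  have e : a * (y.1 - p.1) + b * (y.2 - p.2) = 0.
    move: ly lp; rewrite (affine_planeE p (al i0)) (affine_planeE y (al i0)).
    by rewrite -/a -/b; lra.
  have n1 : a ^+ 2 + b ^+ 2 != 0 by rewrite gt_eqF.
  apply/eqP; rewrite -subr_eq0; apply/eqP; case: y ly e => y1 y2 /= _ e.
  congr (_, _); rewrite /= /GRing.scale /=; apply: (mulIf n1); rewrite mul0r.
    by transitivity (a * (a * (y1 - p.1) + b * (y2 - p.2)));
      [field | rewrite e mulr0].
  by transitivity (b * (a * (y1 - p.1) + b * (y2 - p.2)));
    [field | rewrite e mulr0].
have Cp : C p by move=> i.
(* If a functional vanishing at [p] varies along the line, the cell is the single point [p],
   represented by a degenerate segment. *)
have [/existsP[i /andP[/eqP li mi]]|/existsPn nm] :=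
  boolP [exists i, (l i p == 0) && (m i != 0)].
  exists p, p; apply/seteqP; split=> [_ [t _ <-]|y Cy].
    by rewrite /path_point -scalerDl subrK scale1r.
  have [t yE] := Cline _ Cy; exists 2^-1; first by rewrite /=; lra.
  rewrite /path_point -scalerDl subrK scale1r yE.
  have := Cy i; rewrite yE lpd li sgr0 add0r => /eqP.
  by rewrite sgr_cp0 mulf_eq0 (negbTE mi) orbF => /eqP ->; rewrite scale0r addr0.
(* Now each functional vanishing at [p] vanishes on the whole line, so only strict conditions
   remain: [T] is an open bounded interval, and its [inf] and [sup] give the endpoints. *)
pose T := [set t | C (p + t *: d)].
have TI : is_interval T.
  move=> s t Ts Tt z /andP[sz zt] i.
  have [st|st] := eqVneq s t; first by have -> : z = s by lra.
  have st0 : t - s != 0 by rewrite subr_eq0 eq_sym.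
  rewrite lpd (_ : _ + _ = (1 - (z - s) / (t - s)) * l i (p + s *: d) +
    (z - s) / (t - s) * l i (p + t *: d)); last by rewrite !lpd; field.
  rewrite sgr_conv ?(Ts i) ?(Tt i)//.
  by rewrite divr_ge0 ?ler_pdivrMr /=; lra.
have oT : open T.
  rewrite openE => t Tt.
  have cT i : {for t, continuous (fun s : R => l i (p + s *: d))}.
    rewrite (_ : (fun s : R => _) = (fun s => l i p + s * m i)).
      by apply: cvgD; [exact: cvg_cst|apply: cvgMl; exact: cvg_id].
    by apply/funext => s; rewrite lpd.
  apply: filterS (near_same_signs cT) => s ls i.
  have [p0|p0] := eqVneq (l i p) 0.
    have := nm i; rewrite p0 eqxx /= negbK => /eqP m0.
    by rewrite lpd m0 mulr0 addr0 p0.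
  by rewrite ls ?(Tt i)// -sgr_eq0 (Tt i) sgr_eq0.
have [M TM] : exists M, forall t, T t -> `|t| <= M.
  (* From the triangle inequality for [t *: d = - p + (p + t *: d)]; the [+ 1] is there because
     [bounded_set] provides only bounds strictly above [M]. *)
  have [M [_ CM]] := bC; exists ((M + 1 + `|p|) / `|d|) => t Tt.
  have d0 : 0 < `|d|.
    rewrite normr_gt0; apply: contraL n0 => /eqP[b0 a0].
    by rewrite a0 -[b]opprK b0 oppr0 expr0n addr0 ltxx.
  rewrite ler_pdivlMr// -normrZ -(addKr p (t *: d)).
  rewrite (le_trans (ler_normD _ _))// normrN addrC lerD2r.
  by apply: CM => //; rewrite ltrDl.
have TP s : T s <-> inf T < s < sup T.
  suff {1}-> : T = [set t | inf T < t < sup T] by [].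
  rewrite -(interval_bounded_interior TI).
  - by apply/esym/interior_id.
  - by exists (- M) => t /TM; rewrite ler_norml => /andP[].
  - by exists M => t /TM; rewrite ler_norml => /andP[].
exists (p + inf T *: d), (p + sup T *: d).
have T0 : T 0 by rewrite /T /= scale0r addr0.
have s1 : 0 < sup T - inf T by move/TP: T0; lra.
have ppE t : path_point (p + inf T *: d) (p + sup T *: d) t =
    p + ((1 - t) * inf T + t * sup T) *: d.
  by apply/eqP; rewrite -subr_eq0; apply/eqP; congr (_, _);
    rewrite /= /GRing.scale /=; ring.
apply/seteqP; split=> [_ [t /andP[t0 t1] <-]|y Cy].
  rewrite ppE; apply/TP.
  have t2 : 0 < 1 - t by lra.
  have := mulr_gt0 t0 s1; have := mulr_gt0 t2 s1; lra.
have [t yE] := Cline _ Cy.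
have Tt : T t by rewrite /T /= -yE.
move: Tt => /TP/andP[t0 t1].
have s0 : sup T - inf T != 0 by rewrite gt_eqF.
exists ((t - inf T) / (sup T - inf T)).
  by apply/andP; split; rewrite ?divr_gt0 ?ltr_pdivrMr ?mul1r//; lra.
by rewrite ppE yE; congr (_ + _ *: _); field.
Qed.

Lemma segment_interior_sub (R : realType) (u v : plane R) :
  segment_interior u v `<=` segment u v.
Proof. by move=> _ [t /andP[t0 t1] <-]; exists t => //=; rewrite !ltW. Qed.

Lemma segment_sub_closure (R : realType) (u v : plane R) :
  segment u v `<=` closure (segment_interior u v).
Proof.
move=> _ [t t01 <-] N Nt.
(* Pulling the parameter towards 1/2 makes it strictly interior for [0 < s < 1], even when [t] is 0
   or 1. *)
pose g (s : R) := path_point u v ((1 - s) * t + s / 2).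
have cg : {for 0, continuous g}.
  apply: (@continuous_comp _ _ _ (fun s : R => (1 - s) * t + s / 2)).
    apply: cvgD; apply: cvgMl; last exact: cvg_id.
    by apply: cvgB; [exact: cvg_cst|exact: cvg_id].
  exact: path_continuous.
have near_N : \forall s \near (0 : R), N (g s).
  by apply: cg; rewrite /g subr0 mul1r mul0r addr0.
have [s [s0 s1 Ns]] : exists s, [/\ 0 < s, s < 1 & N (g s)].
  near (0 : R)^'+ => s; exists s; split; near: s.
  - exact: nbhs_right_gt.
  - exact: nbhs_right_lt.
  - exact: (cvg_within _ near_N).
exists (g s); split=> //; exists ((1 - s) * t + s / 2) => //=.
by case/andP: t01 => t0 t1; apply/andP; split; nra.
Unshelve. all: by end_near. Qed.

Lemma semilinear_polygonal (R : realType) (X : set (plane R)) :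
  semilinear X -> closed X -> bounded_set X -> polygonal_region X.
Proof.
move=> [I [l [al lX]]] cX bX; split=> //.
have lB := saturated_boundary al lX.
have cB : closed (boundary X).
  apply: closedI; first exact: closed_closure.
  exact/open_closedC/open_interior.
have BX : boundary X `<=` X by move=> x []; rewrite -((closure_id X).1 cX).
(* Sign vectors coded in a finite type, so that the cells meeting the boundary can be enumerated. *)
pose sv p : {ffun I -> bool * bool} := [ffun i => (0 < l i p, l i p < 0)].
have svP p q : sv p = sv q <-> forall i, Num.sg (l i p) = Num.sg (l i q).
  split=> [/ffunP pq i|pq]; last first.
    apply/ffunP => i; rewrite !ffunE -(sgr_gt0 (l i p)) -(sgr_lt0 (l i p)).
    by rewrite pq sgr_gt0 sgr_lt0.
  have := pq i; rewrite !ffunE => -[].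
  case: (ltgtP (l i p) 0) => p0; case: (ltgtP (l i q) 0) => q0 // _ _;
    by [rewrite !ltr0_sg | rewrite !gtr0_sg | rewrite p0 q0].
pose K := [pred s | `[< exists2 p, boundary X p & sv p = s >]].
have cells (k : 'I_#|K|) : exists uv : plane R * plane R,
    exists2 p, boundary X p /\ sv p = enum_val k &
      segment_interior uv.1 uv.2 = [set y | sv y = enum_val k].
  have /asboolP[p Bp pk] := enum_valP k.
  have [i0 [l0 x0]] := boundary_zero al lX Bp.
  have E : [set y | sv y = enum_val k] =
      [set y | forall i, Num.sg (l i y) = Num.sg (l i p)].
    by apply/seteqP; split=> y /=; rewrite -pk => /svP.
  have [|u [v uvE]] := bounded_cell al l0 x0.
    have [M [Mr XM]] := bX; exists M; split=> // N MN y ly.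
    by apply: XM MN _ _; apply: BX; apply: lB Bp => i; rewrite ly.
  by exists (u, v), p => //; rewrite E.
have [f fP] := choice cells.
have fB k : segment_interior (f k).1 (f k).2 `<=` boundary X.
  have [p [Bp pk] ->] := fP k => y /=; rewrite -pk => /svP yp.
  by apply: lB Bp => i; rewrite yp.
exists #|K|, (fun k => (f k).1), (fun k => (f k).2); split.
  move=> i j _ _ [y []]; have [_ _ ->] := fP i; have [_ _ ->] := fP j.
  by move=> /= -> /enum_val_inj.
(* Adding the endpoints to the open cells does not leave the boundary, because it is closed. *)
apply/seteqP; split=> [p Bp|p [k _] /segment_sub_closure kp].
  have Kp : sv p \in K by apply/asboolP; exists p.
  exists (enum_rank_in Kp (sv p)) => //.
  apply: segment_interior_sub.
  by have [_ _ ->] := fP (enum_rank_in Kp (sv p)); rewrite /= enum_rankK_in.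
by rewrite ((closure_id _).1 cB); apply: closure_subset kp; exact: fB.
Qed.

(** * Compactness and openness of Minkowski sums *)

Lemma plane_compact (R : realType) (X : set (plane R)) :
  closed X -> bounded_set X -> compact X.
Proof.
move=> cX [M [_ XM]].
apply: (@subclosed_compact _ _ (`[- (M + 1), M + 1] `*` `[- (M + 1), M + 1])) => //.
  by apply: compact_setX; exact: segment_compact.
have M1 : M < M + 1 by rewrite ltrDl.
move=> x /(XM _ M1); rewrite /= ge_max !ler_norml => /andP[x1 x2].
by split; rewrite /= in_itv.
Qed.

Lemma minkowski_compact (R : realType) (X Y : set (plane R)) :
  compact X -> compact Y -> compact (minkowski X Y).
Proof.
move=> kX kY.
rewrite (_ : minkowski X Y = [set z.1 + z.2 | z in X `*` Y]).
  apply: continuous_compact; last exact: compact_setX.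
  by apply: continuous_subspaceT => z; exact: add_continuous.
apply/seteqP; split=> [_ [x Xx [y Yy <-]]|_ [[x y] [Xx Yy] <-]].
  by exists (x, y).
by exists x => //; exists y.
Qed.

Lemma plane_hausdorff (R : realType) : hausdorff_space (plane R).
Proof. exact: norm_hausdorff. Qed.

Lemma disk_compact (R : realType) (s : R) : compact (disk 0 s).
Proof.
apply: plane_compact.
  rewrite (_ : disk 0 s = (fun x : plane R =>
      Num.sqrt (x.1 * x.1 + x.2 * x.2)) @^-1` [set t | t <= s]).
    have : continuous (fun x : plane R => Num.sqrt (x.1 * x.1 + x.2 * x.2)).
      move=> x; apply: continuous_comp; last exact: sqrt_continuous.
      by apply: cvgD; apply: cvgM; (exact: cvg_fst || exact: cvg_snd).
    by move/continuous_closedP; apply; exact: closed_le.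
  by apply/seteqP; split=> x; rewrite /disk /edist2 /= !sub0r !sqrrN !expr2.
exists s; split=> [|M sM x xs]; first exact: num_real.
have h (y : R) : `|y| = Num.sqrt (y ^+ 2) by rewrite sqrtr_sqr.
rewrite /= ge_max; apply/andP; split;
  rewrite (le_trans _ (ltW sM))// (le_trans _ xs)// h /edist2 /= ler_wsqrtr//
    !sub0r !sqrrN ?lerDl ?lerDr ?sqr_ge0//.
Qed.

Lemma compact_semilinear_approx_disk (R : realType) (a b : R) D :
  approx_disk a b D -> compact D /\ semilinear D.
Proof.
move=> [[n [v [_ [_ _ bD rD bE]]]] _ _ _].
have cD : closed D by rewrite -rD; exact: closed_closure.
by split; [exact: plane_compact|exact: semilinear_of_boundary bE].
Qed.

Lemma minkowski_open (R : realType) (X Y : set (plane R)) :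
  open X -> open (minkowski X Y).
Proof.
move=> oX.
rewrite (_ : minkowski X Y = \bigcup_(y in Y) ((fun z => z - y) @^-1` X)).
  apply: bigcup_open => y _; apply: open_comp => // z _.
  by apply: cvgB; [exact: cvg_id|exact: cvg_cst].
apply/seteqP; split=> [_ [x Xx [y Yy <-]]|z [y Yy Xzy]].
  by exists y; rewrite //= addrK.
by exists (z - y) => //; exists y; rewrite ?subrK.
Qed.

(** * Euclidean disks and Hausdorff distance *)

Lemma edist2E (R : realType) (x y : plane R) : edist2 x y = edist2 0 (y - x).
Proof. by rewrite /edist2 /= !sub0r !opprB. Qed.

Lemma edist2C (R : realType) (x y : plane R) : edist2 x y = edist2 y x.
Proof. by rewrite /edist2 -(sqrrN (x.1 - _)) -(sqrrN (x.2 - _)) !opprB. Qed.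

Lemma disk0N (R : realType) (s : R) x : disk 0 s x -> disk 0 s (- x).
Proof. by rewrite /disk /edist2 /= !sub0r !sqrrN. Qed.

Lemma disk0Z (R : realType) (s t : R) x :
  0 <= t -> disk 0 s x -> disk 0 (t * s) (t *: x).
Proof.
move=> t0; rewrite /disk /=.
have -> : edist2 0 (t *: x) = t * edist2 0 x.
  rewrite -{2}(ger0_norm t0) -sqrtr_sqr -sqrtrM ?sqr_ge0// /edist2 /=.
  by congr Num.sqrt; rewrite /GRing.scale /=; ring.
exact: ler_wpM2l.
Qed.

(** Divide the vector [x] along itself in the ratio [s : t]. *)
Lemma disk0D (R : realType) (s t : R) x : 0 < s -> 0 < t ->
  disk 0 (s + t) x -> exists y z, [/\ disk 0 s y, disk 0 t z & x = y + z].
Proof.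
move=> s0 t0 xst; have st : s + t != 0 by rewrite gt_eqF ?addr_gt0.
have st0 : 0 <= (s + t)^-1 by rewrite invr_ge0 ltW ?addr_gt0.
exists ((s / (s + t)) *: x), ((t / (s + t)) *: x); split.
- by rewrite -{1}(divfK st s); apply: disk0Z => //; rewrite mulr_ge0// ltW.
- by rewrite -{1}(divfK st t); apply: disk0Z => //; rewrite mulr_ge0// ltW.
- by rewrite -scalerDl -mulrDl divff// scale1r.
Qed.

Lemma hausdorff_dist_le (R : realType) (A B : set (plane R)) (e : R) :
  (forall x, A x -> exists2 y, B y & edist2 x y <= e) ->
  (forall y, B y -> exists2 x, A x & edist2 y x <= e) ->
  (hausdorff_dist A B <= e%:E)%E.
Proof.
move=> AB BA; rewrite ge_max; apply/andP; split.
  apply: ge_ereal_sup => _ [x /AB[y By xy] <-].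
  by apply: ge_ereal_inf; exists (edist2 x y)%:E; [exists y|rewrite lee_fin].
apply: ge_ereal_sup => _ [x /BA[y By xy] <-].
by apply: ge_ereal_inf; exists (edist2 x y)%:E; [exists y|rewrite lee_fin].
Qed.

(** * Correctness of the interior approximation *)

Unset Implicit Arguments.

Theorem lemma9 (R : realType) (Dbar : R -> R -> set (plane R))
    (hDbar : forall a b : R, 0 <= a -> a < b -> approx_disk a b (Dbar a b))
    (Q : set (plane R)) (r eps delta : R)
    (hQ : polygonal_region Q) (hQb : bounded_set Q)
    (hr : 0 < r) (hdelta : 0 < delta) (heps : delta < eps)
    (hyes : ApproxDecideInterior Dbar Q r eps delta = YES) :
  [/\ Decide Q r eps = YES,
      exists P : set (plane R),
        polygonal_region P /\ eps_close eps (offset P r) Q,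
      polygonal_region (hatPi Dbar Q r eps delta) &
      eps_close eps (offset (hatPi Dbar Q r eps delta) r) Q].
Proof.
set P := hatPi Dbar Q r eps delta.
pose D1 := Dbar (eps - delta) eps; pose D2 := Dbar r (r + delta).
pose D3 := Dbar (r + eps - delta) (r + eps).
have a1 : approx_disk (eps - delta) eps D1 by apply: hDbar; lra.
have a2 : approx_disk r (r + delta) D2 by apply: hDbar; lra.
have a3 : approx_disk (r + eps - delta) (r + eps) D3 by apply: hDbar; lra.
have [cQ [n [u [v [_ QE]]]]] := hQ.
have [kD1 sD1] := compact_semilinear_approx_disk a1.
have [_ sD2] := compact_semilinear_approx_disk a2.
have sQ : semilinear Q := semilinear_of_boundary cQ QE.
have kQ : compact Q by exact: plane_compact.
have kQD1 : compact (minkowski Q D1) by exact: minkowski_compact.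
have [_ _ _ D1eps] := a1; have [_ _ rD2 _] := a2; have [_ _ _ D3r] := a3.
have QP : Q `<=` minkowski P D3.
  by move: hyes; rewrite /ApproxDecideInterior -/D3 -/P; case: asboolP.
(* Because [D2] contains the symmetric disk of radius [r], a point [x + d] outside the sum would
   exclude [x = (x + d) + (- d)] from [P]. *)
have PrQ x d : P x -> disk 0 r d -> minkowski Q D1 (x + d).
  move=> Px rd; apply: contrapT => nQ; apply: Px; exists (x + d) => //.
  by exists (- d); [exact/rD2/disk0N|rewrite addrK].
have D0 : disk 0 r 0.
  by rewrite /disk /edist2 /= subrr expr0n addr0 sqrtr0 ltW.
have PQ : P `<=` minkowski Q D1 by move=> x Px; rewrite -(addr0 x); exact: PrQ.
have cP : closed P.
  apply: open_closedC; apply: minkowski_open.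
  by apply: closed_openC; apply: compact_closed => //; exact: plane_hausdorff.
have bP : bounded_set P.
  have [M [Mr QM]] := compact_bounded kQD1.
  by exists M; split=> // N MN x /PQ; exact: QM.
have polP : polygonal_region P.
  apply: semilinear_polygonal => //; apply: semilinearC.
  apply: semilinear_minkowski => //; apply: semilinearC.
  exact: semilinear_minkowski.
have closeP : eps_close eps (offset P r) Q.
  split=> //.
    apply: compact_closed; first exact: plane_hausdorff.
    by apply: minkowski_compact; [exact: plane_compact|exact: disk_compact].
  apply: hausdorff_dist_le => [_ [x Px [d rd <-]]|y Qy].
    have [q Qq [e /D1eps eD <-]] := PrQ _ _ Px rd.
    by exists q => //; rewrite edist2C edist2E addrAC subrr add0r.
  (* The vector [d] of length at most [r + eps] splits into [f] of length at most [r], which leads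
     into the offset of [P], and a remainder of length at most [eps]. *)
  have [x Px [d /D3r dr <-]] := QP _ Qy.
  have [|f [e [fr ee ->]]] := disk0D hr _ dr; first by lra.
  exists (x + f); first by exists x => //; exists f.
  by rewrite edist2C edist2E (addrA x) [_ + e]addrC addrK.
split=> //; last by exists P.
rewrite /Decide; case: asboolP => // nQ; exfalso; apply: nQ.
(* The same [x] serves for [Decide]: [P] lies in the exact inset, since [D1] is contained in the
   disk of radius [eps]. *)
move=> y /QP[x Px [d /D3r dr <-]].
exists x; last by exists d.
move=> [z nz [e re zx]]; apply: nz.
have [q Qq [f /D1eps fe E]] := PrQ _ _ Px (disk0N re).
exists q => //; exists f => //.
by rewrite E -zx addrK.
Qed.
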